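(* $t(2)=3$.
   Context: Let $\mathfrak{C}=\{0,1\}^n$ be the vertex set of the $n$-dimensional hypercube; $\oplus,\wedge$ denote bitwise XOR and AND. An outmap is any function $s:\mathfrak{C}\to\{0,1\}^n$. A clash of $s$ is a pair of distinct vertices $u,v$ with $(s(u)\oplus s(v))\wedge(u\oplus v)=0^n$. A query at $u$ to the oracle for $s$ returns $s(u)$; algorithms choose queries adaptively, and only the number of queries is counted. \textsc{Sink-or-Clash}: given oracle access to an arbitrary outmap $s$, query either a vertex $u$ with $s(u)=0^n$ or both vertices of some clash. $t(n)=\min_{\mathcal A}\max_s t(\mathcal A,s)$, where $\mathcal A$ ranges over deterministic algorithms solving \textsc{Sink-or-Clash} on all outmaps of the $n$-cube and $t(\mathcal A,s)$ is the number of queries made on $s$. *)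

(* Defs.v *)
(* boolp is used only to turn the predicate to be minimised into a boolean one. *)
From mathcomp Require Import all_boot.
From mathcomp Require Import boolp.

Set Implicit Arguments.
Unset Strict Implicit.
Unset Printing Implicit Defensive.

Definition cube (n : nat) : finType := {ffun 'I_n -> bool}.

Definition zero_vec (n : nat) : cube n := [ffun=> false].
Definition xor_vec (n : nat) (a b : cube n) : cube n :=
  [ffun i => a i (+) b i].
Definition and_vec (n : nat) (a b : cube n) : cube n :=
  [ffun i => a i && b i].

Definition outmap (n : nat) : finType := {ffun cube n -> cube n}.

Definition is_sink (n : nat) (s : outmap n) (u : cube n) : bool :=
  s u == zero_vec n.

Definition is_clash (n : nat) (s : outmap n) (u v : cube n) : bool :=
  (u != v) && (and_vec (xor_vec (s u) (s v)) (xor_vec u v) == zero_vec n).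

(* A deterministic adaptive query algorithm is a decision tree: it either
   halts, or queries a vertex and continues in a way that depends on the
   oracle's answer. It accesses the outmap only through the answers. *)
Inductive algorithm (n : nat) : Type :=
| Halt
| Query of cube n & (cube n -> algorithm n).

Arguments Halt {n}.

Fixpoint queried (n : nat) (A : algorithm n) (s : outmap n) : seq (cube n) :=
  match A with
  | Halt => [::]
  | Query u next => u :: queried (next (s u)) s
  end.

Definition num_queries (n : nat) (A : algorithm n) (s : outmap n) : nat :=
  size (queried A s).

Definition solves_on (n : nat) (A : algorithm n) (s : outmap n) : Prop :=
  (exists2 u, u \in queried A s & is_sink s u) \/
  (exists u v, [/\ u \in queried A s, v \in queried A s & is_clash s u v]).

Definition solves (n : nat) (A : algorithm n) : Prop :=
  forall s : outmap n, solves_on A s.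

Definition worst_case (n : nat) (A : algorithm n) : nat :=
  \max_(s : outmap n) num_queries A s.

Definition attained (n : nat) : pred nat :=
  fun m => `[< exists A : algorithm n, solves A /\ worst_case A = m >].

(* Some algorithm solves the problem (query every vertex), so the minimum
   below is over a nonempty set: an outmap that is not injective has a clash,
   and one that is injective is onto, hence has a sink. *)
Lemma attained_nonempty (n : nat) : exists m, attained n m.
Proof.
pose A := foldr (fun u B => Query u (fun=> B)) Halt (enum (cube n)).
have qA s : queried A s = enum (cube n).
  by rewrite /A; elim: (enum (cube n)) => //= u l ->.
exists (worst_case A); apply/asboolP; exists A; split=> // s.
rewrite /solves_on qA.
have [/injectiveP s_inj | /injectivePn[u [v uv suv]]] := boolP (injectiveb s).
  left; exists (invF s_inj (zero_vec n)); first by rewrite mem_enum.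
  by rewrite /is_sink f_invF.
right; exists u, v; rewrite !mem_enum; split=> //.
rewrite /is_clash uv; apply/eqP/ffunP=> i.
by rewrite !ffunE suv addbb.
Qed.

Definition t (n : nat) : nat := ex_minn (attained_nonempty n).

(* Main.v *)
(* Lower bound, for every [n > 1]: answer the first query [u] with the all-ones
   vector and a second query [v <> u] with all ones except for a zero in one
   coordinate where [u] and [v] differ; this makes neither a sink nor a clash.

   Upper bound: query 00 and 11, with answers [x] and [y]. If these are nonzero
   and do not clash, i.e. are distinct, then [x_0 = y_1 = 1] or [x_1 = y_0 = 1].
   In the former case the only answer at 10 that clashes with neither of them is
   00, in the latter case the same holds at 01. *)
Require Import Defs.
From mathcomp Require Import all_boot.
From mathcomp Require Import boolp.

Set Implicit Arguments.
Unset Strict Implicit.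
Unset Printing Implicit Defensive.

Lemma is_clashP (n : nat) (s : outmap n) (u v : cube n) :
  reflect (u != v /\ forall i, u i != v i -> s u i = s v i) (is_clash s u v).
Proof.
apply: (iffP andP) => -[uv H]; split=> //.
  move=> i; move/eqP/ffunP: H => /(_ i); rewrite !ffunE.
  by case: (s u i) (s v i) (u i) (v i) => -[] [] [].
apply/eqP/ffunP=> i; rewrite !ffunE; move: (H i).
by case: (s u i) (s v i) (u i) (v i) => -[] [] [] // /(_ isT).
Qed.

Lemma is_clash_sym (n : nat) (s : outmap n) (u v : cube n) :
  is_clash s u v = is_clash s v u.
Proof.
by apply/is_clashP/is_clashP => -[uv H]; split; rewrite 1?eq_sym // => i;
  rewrite eq_sym => /H.
Qed.

Lemma is_clash_irr (n : nat) (s : outmap n) (u : cube n) : ~~ is_clash s u u.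
Proof. by rewrite /is_clash eqxx. Qed.

(** The case [u = v] is allowed on purpose: it serves algorithms that stop after a single query or
    query the same vertex twice. *)
Lemma two_query_adversary (n : nat) (u v : cube n) : 1 < n ->
  exists s : outmap n,
    [/\ s u = [ffun=> true], forall x, ~~ is_sink s x & ~~ is_clash s u v].
Proof.
case: n u v => [|[|n]] // u v _.
have [<-|uv] := eqVneq u v.
  exists [ffun=> [ffun=> true]]; split; rewrite ?ffunE ?is_clash_irr // => x.
  by apply/eqP=> /ffunP/(_ ord0); rewrite !ffunE.
have [i uvi] : exists i, u i != v i.
  apply/existsP; apply: contraNT uv; rewrite negb_exists => /forallP H.
  by apply/eqP/ffunP=> i; apply/eqP/negbNE/H.
exists [ffun x => [ffun j => (x != v) || (j != i)]]; split.
- by apply/ffunP=> j; rewrite !ffunE uv.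
(* [lift i ord0] is a coordinate other than [i], available because the dimension is at least 2;
   every answer has a one there. *)
- move=> x; apply/eqP=> /ffunP/(_ (lift i ord0)).
  by rewrite !ffunE [lift _ _ == _]eq_sym neq_lift orbT.
- by apply/is_clashP=> -[_ /(_ i uvi)]; rewrite !ffunE uv !eqxx.
Qed.

(** With no sink to find, success must come from a clash; being irreflexive and symmetric, a clash
    inside [[:: u; v]] can only be that of [u] with [v]. *)
Lemma solves_on_sub (n : nat) (A : algorithm n) (s : outmap n) (u v : cube n) :
    {subset queried A s <= [:: u; v]} -> (forall x, ~~ is_sink s x) ->
  solves_on A s -> is_clash s u v.
Proof.
move=> sub nosink [[x _]|[x [y [/sub + /sub]]]]; first by rewrite (negPf (nosink x)).
rewrite !inE => /orP[]/eqP-> /orP[]/eqP-> //; rewrite ?(negPf (is_clash_irr _ _)) //.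
by rewrite is_clash_sym.
Qed.

Lemma worst_case_gt2 (n : nat) (A : algorithm n) :
  1 < n -> solves A -> 2 < worst_case A.
Proof.
move=> n1 solA.
suff [s lt2] : exists s, 2 < num_queries A s.
  exact: leq_trans lt2 (leq_bigmax s).
case: A solA => [|u f] solA.
  by case: (solA [ffun=> zero_vec n]) => [[]|[? [? []]]].
case E: (f [ffun=> true]) => [|v g].
  (* The tree halts after its only query [u], so a success would make [u] clash with itself. *)
  have [s [su nosink /negP[]]] := two_query_adversary u u n1.
  apply: solves_on_sub nosink (solA s) => x /=.
  by rewrite su E !inE orbb.
have [s [su nosink noclash]] := two_query_adversary u v n1.
exists s; rewrite ltnNge; apply: contra noclash.
(* At most two queries in total means that nothing is queried after [v]. *)
rewrite /num_queries /= su E /= !ltnS leqn0 size_eq0 => /eqP q0.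
by apply: solves_on_sub nosink (solA s) => x; rewrite /= su E /= q0.
Qed.

Definition vec2 (a b : bool) : cube 2 := [ffun i => if i == ord0 then a else b].

(** Testing [x ord0 && y ord_max] is enough: if it fails and the first two answers give neither a
    sink nor a clash, the other pair of bits is all ones. *)
Definition three_queries : algorithm 2 :=
  Query (vec2 false false) (fun x =>
  Query (vec2 true true) (fun y =>
  Query (if x ord0 && y ord_max then vec2 true false else vec2 false true)
    (fun=> Halt))).

Lemma vec2P (x : cube 2) : exists a b, x = vec2 a b.
Proof.
exists (x ord0), (x ord_max); apply/ffunP=> i; rewrite ffunE.
by case: eqP => [->//|/eqP]; case: i => -[|[|]] // Hi _; congr (x _); apply/val_inj.
Qed.

Lemma vec2_eq (a b c d : bool) :
  (vec2 a b == vec2 c d) = (a == c) && (b == d).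
Proof.
apply/eqP/andP=> [/ffunP E|[/eqP-> /eqP->]] //.
by have := E ord0; have := E ord_max; rewrite !ffunE /= => -> ->.
Qed.

Lemma is_sink2 (s : outmap 2) (u : cube 2) (a b : bool) :
  s u = vec2 a b -> is_sink s u = ~~ a && ~~ b.
Proof.
have -> : is_sink s u = (s u == vec2 false false).
  by congr (_ == _); apply/ffunP=> i; rewrite !ffunE if_same.
by move=> ->; rewrite vec2_eq !eqbF_neg.
Qed.

Lemma is_clash2 (s : outmap 2) (a b c d a' b' c' d' : bool) :
    s (vec2 a b) = vec2 a' b' -> s (vec2 c d) = vec2 c' d' ->
  is_clash s (vec2 a b) (vec2 c d) =
    [&& (a != c) || (b != d), (a != c) ==> (a' == c') & (b != d) ==> (b' == d')].
Proof.
move=> su sv; rewrite -negb_and -vec2_eq.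
apply/is_clashP/and3P; rewrite su sv.
  move=> -[uv H]; split=> //; apply/implyP.
    by move=> ac; have := H ord0; rewrite !ffunE /= => ->.
  by move=> bd; have := H ord_max; rewrite !ffunE /= => ->.
move=> [uv /implyP H0 /implyP H1]; split=> // i; rewrite !ffunE.
by case: ifP => _ => [/H0|/H1] /eqP.
Qed.

Lemma three_queries_solves : solves three_queries.
Proof.
move=> s.
have [a [b s00]] := vec2P (s (vec2 false false)).
have [c [d s11]] := vec2P (s (vec2 true true)).
pose w := if a && d then vec2 true false else vec2 false true.
have q : queried three_queries s = [:: vec2 false false; vec2 true true; w].
  by rewrite /= s00 s11 !ffunE.
have [e [f sw]] := vec2P (s w).
have : [|| is_sink s (vec2 false false), is_sink s (vec2 true true), is_sink s w,
    is_clash s (vec2 false false) (vec2 true true),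
    is_clash s (vec2 false false) w | is_clash s (vec2 true true) w].
  rewrite (is_sink2 s00) (is_sink2 s11) (is_sink2 sw) (is_clash2 s00 s11).
  move: sw; rewrite /w; case: ifP => ad sw;
    rewrite (is_clash2 s00 sw) (is_clash2 s11 sw);
    (* Only a propositional formula in the six answer bits is left, checked by its truth table. *)
    by case: a b c d e f ad {s00 s11 sw w q} => -[] [] [] [] [].
rewrite /solves_on q => H.
case/or4P: H => [H|H|H|/or3P[]H];
  [left; eexists; last exact: H | left; eexists; last exact: H
  | left; eexists; last exact: H | right; do 2 eexists; split; last exact: H
  | right; do 2 eexists; split; last exact: H
  | right; do 2 eexists; split; last exact: H];
  by rewrite !inE eqxx ?orbT.
Qed.

Lemma worst_case_three_queries : worst_case three_queries = 3.
Proof.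
apply/eqP; rewrite eqn_leq worst_case_gt2 ?andbT //; last exact: three_queries_solves.
(* Every branch of the tree has exactly three queries, so each term of the maximum computes to 3. *)
exact/bigmax_leqP.
Qed.

Theorem lemma23 : t 2 = 3.
Proof.
rewrite /t; case: ex_minnP => m /asboolP[A [solA <-]] min.
apply/eqP; rewrite eqn_leq worst_case_gt2 // andbT min //.
apply/asboolP; exists three_queries; split.
  exact: three_queries_solves.
exact: worst_case_three_queries.
Qed.
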